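(* Let $A\in\mathbb{R}^{m\times n}$ with full SVD $A=P\Sigma S^T$ and singular values $\sigma_1\ge\sigma_2\ge\cdots$, and let $1\le k\le l\le\min(m,n)$. Let $V=V'R'\in\mathbb{R}^{n\times n}$ be structured as in the context, let $AV=QR$ with $Q\in\mathbb{R}^{m\times m}$ orthogonal and $R\in\mathbb{R}^{m\times n}$ upper triangular, $Q_1=Q[:,:l]$, and block $R$ so that $R_{11}$ is $l\times l$ and $R_{22}$ is $(m-l)\times(n-l)$. Assume that the $k\times l$ block $(S^TV)_{11}$ has full row rank. Then the singular values of $Q_1Q_1^TA-A$ are identical to those of $R_{22}$. Moreover, $$\|R_{22}\|_F^2\le\|\Sigma_2\|_F^2+\|\Sigma_2(S^TV)_{21}(S^TV)_{11}^+\|_F^2 .$$ Also, for $1\le j\le k$, $$\sigma_j(A)\ \ge\ \sigma_j(Q_1Q_1^TA)\ \ge\ \sigma_j(R_{11}R_{11}'^{-1})\ \ge\ \sigma_j(A)\,\sigma_{\min}\big((S^TV')_{11}\big).$$ As well, for any given $1\le j\le\min(m,n)-k$ there is an orthogonal $n\times n$ matrix $\tilde S$, independent of $V$, such that $$\sigma_j^2(R_{22})\le\sigma_{j+k}^2+\|\Sigma_{j,2}(\tilde S^TV)_{21}(\tilde S^TV)_{11}^+\|_2^2,$$ $$\|R_{22}-(R_{22})_{\mathrm{opt},j-1}\|_F^2\le\|\Sigma_{j,2}\|_F^2+\|\Sigma_{j,2}(\tilde S^TV)_{21}(\tilde S^TV)_{11}^+\|_F^2 .$$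
   Context: Singular values are in decreasing order (and are $0$ beyond the matrix dimensions); $X^+$ is the Moore–Penrose pseudo-inverse, and $X_{11}^+$ means $(X_{11})^+$; $X_{\mathrm{opt},r}$ is the rank-$r$ truncated SVD of $X$. $X[:,:l]$ denotes the first $l$ columns of $X$. Structure of $V$: $V=V'R'$ with $V'$ an $n\times n$ orthogonal matrix and $R'=\begin{pmatrix}R'_{11}&0\\0&I_{n-l}\end{pmatrix}$, $R'_{11}$ an invertible $l\times l$ upper triangular matrix. In $A=P\Sigma S^T$, $P$ is $m\times m$ orthogonal, $S$ is $n\times n$ orthogonal, $\Sigma$ is $m\times n$ diagonal; $\Sigma_2=\Sigma[k+1:,k+1:]$ is its trailing $(m-k)\times(n-k)$ block. For $M=S^TV$, $\tilde S^TV$ or $S^TV'$: $M_{11}=M[:k,:l]$ is the leading $k\times l$ block and $M_{21}=M[k+1:,:l]$ consists of the remaining rows of the first $l$ columns. For a $k\times l$ matrix with $k\le l$, $\sigma_{\min}$ is the $k$-th singular value. $\Sigma_{j,2}$ is the $(m-k)\times(n-k)$ diagonal matrix with diagonal $(\sigma_{k+j},\dots,\sigma_{\min(m,n)},0,\dots,0)$. *)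

(* Defs.v *)
From mathcomp Require Import all_boot all_order all_algebra.
From mathcomp Require Import boolp classical_sets reals.

Set Implicit Arguments.
Unset Strict Implicit.
Unset Printing Implicit Defensive.

Import Order.TTheory GRing.Theory Num.Theory.
Local Open Scope classical_set_scope.
Local Open Scope ring_scope.

Lemma tail_ord_subproof (m p : nat) (i : 'I_(m - p)) : (p + i < m)%N.
Proof. by rewrite -ltn_subRL. Qed.

Definition tail_ord (m p : nat) (i : 'I_(m - p)) : 'I_m :=
  Ordinal (tail_ord_subproof i).

Section Blocks.
Variables (K : realType) (m n : nat).

Definition first_cols (q : nat) (hq : (q <= n)%N) (X : 'M[K]_(m, n)) :
  'M[K]_(m, q) := colsub (widen_ord hq) X.

(* the leading p x q block X[:p, :q] *)
Definition ulblock (p q : nat) (hp : (p <= m)%N) (hq : (q <= n)%N)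
  (X : 'M[K]_(m, n)) : 'M[K]_(p, q) := mxsub (widen_ord hp) (widen_ord hq) X.

(* X[p+1:, :q], with rows numbered from 1 *)
Definition dlblock (p q : nat) (hq : (q <= n)%N)
  (X : 'M[K]_(m, n)) : 'M[K]_(m - p, q) :=
  mxsub (@tail_ord m p) (widen_ord hq) X.

(* X[p+1:, q+1:], with rows and columns numbered from 1 *)
Definition drblock (p q : nat) (X : 'M[K]_(m, n)) : 'M[K]_(m - p, n - q) :=
  mxsub (@tail_ord m p) (@tail_ord n q) X.

End Blocks.

Section MatrixNotions.
Variable K : realType.

Definition orthogonal_mx (n : nat) (X : 'M[K]_n) : Prop := X^T *m X = 1%:M.

(* [is_trig_mx] is lower triangularity. *)
Definition upper_trig_mx (m n : nat) (X : 'M[K]_(m, n)) : Prop :=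
  is_trig_mx X^T.

(* the m x n matrix with diagonal s 0, s 1, ..., s (minn m n).-1 *)
Definition rect_diag (m n : nat) (s : nat -> K) : 'M[K]_(m, n) :=
  \matrix_(i, j) (if i == j :> nat then s i else 0).

(* the n eigenvalues of X^T X, with multiplicity, in decreasing order *)
Definition gram_eigenvalues (m n : nat) (X : 'M[K]_(m, n)) : seq K :=
  xget [::] [set s : seq K |
    char_poly (X^T *m X) = \prod_(x <- s) ('X - x%:P) /\ sorted >=%R s].

(* [sigma X j] is the j-th singular value, numbered from 1; it is 0 for
   j > minn m n. The value at j = 0 is meaningless. *)
Definition sigma (m n : nat) (X : 'M[K]_(m, n)) (j : nat) : K :=
  Num.sqrt (nth 0 (gram_eigenvalues X) j.-1).

(* used only for k <= l *)
Definition sigma_min (k l : nat) (X : 'M[K]_(k, l)) : K := sigma X k.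

(* full SVD: A = P D S^T *)
Definition is_svd (m n : nat) (A : 'M[K]_(m, n))
    (P : 'M[K]_m) (D : 'M[K]_(m, n)) (S : 'M[K]_n) : Prop :=
  [/\ orthogonal_mx P, orthogonal_mx S,
      (exists s : nat -> K, [/\ forall i, 0 <= s i,
         forall i j, (i <= j)%N -> s j <= s i & D = rect_diag m n s])
    & A = P *m D *m S^T].

(* Y is a rank-r truncated SVD of X (there may be several when
   sigma_r(X) = sigma_(r+1)(X)). *)
Definition is_truncated_svd (m n : nat) (r : nat) (X Y : 'M[K]_(m, n)) : Prop :=
  exists P D S, is_svd X P D S /\
    Y = P *m (\matrix_(i, j) (if (i < r)%N then D i j else 0)) *m S^T.

Definition is_pseudo_inverse (m n : nat) (X : 'M[K]_(m, n)) (Y : 'M[K]_(n, m)) :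
    Prop :=
  [/\ X *m Y *m X = X, Y *m X *m Y = Y,
      (X *m Y)^T = X *m Y & (Y *m X)^T = Y *m X].

(* Moore-Penrose; the [pinvmx] of mxalgebra is a different partial inverse. *)
Definition pseudo_inverse (m n : nat) (X : 'M[K]_(m, n)) : 'M[K]_(n, m) :=
  xget 0 [set Y | is_pseudo_inverse X Y].

Definition frobenius_norm (m n : nat) (X : 'M[K]_(m, n)) : K :=
  Num.sqrt (\sum_i \sum_j X i j ^+ 2).

(* operator norm induced by the Euclidean norm, which is the Frobenius norm
   of a column vector *)
Definition spectral_norm (m n : nat) (X : 'M[K]_(m, n)) : K :=
  sup [set frobenius_norm (X *m v) |
       v in [set v : 'cV[K]_n | frobenius_norm v <= 1]].

Definition is_qr (m n : nat) (X : 'M[K]_(m, n)) (Q : 'M[K]_m) (R : 'M[K]_(m, n)) :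
    Prop :=
  [/\ orthogonal_mx Q, upper_trig_mx R & X = Q *m R].

(* V = V' R' with V' orthogonal, R' = diag(R'_11, I_(n-l)) and R'_11 an
   invertible upper triangular l x l matrix *)
Definition is_structured (n l : nat) (ln : (l <= n)%N)
    (V V' : 'M[K]_n) (R11' : 'M[K]_l) : Prop :=
  [/\ orthogonal_mx V', upper_trig_mx R11', R11' \in unitmx
    & V = V' *m castmx (subnKC ln, subnKC ln) (block_mx R11' 0 0 1%:M)].

(* Sigma_(j,2): the (m-k) x (n-k) diagonal matrix with diagonal
   sigma_(k+j)(A), sigma_(k+j+1)(A), ..., which ends in zeros because
   sigma A vanishes beyond minn m n *)
Definition Sigma_j2 (m n : nat) (A : 'M[K]_(m, n)) (k j : nat) :
    'M[K]_(m - k, n - k) :=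
  rect_diag (m - k) (n - k) (fun i => sigma A (k + j + i)).

(* M_21 M_11^+, where M_11 = M[:k, :l] and M_21 = M[k+1:, :l] *)
Definition block_ratio (n k l : nat) (kn : (k <= n)%N) (ln : (l <= n)%N)
    (M : 'M[K]_n) : 'M[K]_(n - k, k) :=
  dlblock k ln M *m pseudo_inverse (ulblock kn ln M).

End MatrixNotions.

(* Main.v *)
Require Import Defs.
From mathcomp Require Import all_boot all_order all_algebra all_fingroup.
From mathcomp Require Import complex.
From mathcomp Require Import boolp classical_sets reals.
From mathcomp Require Import ring lra zify.

Set Implicit Arguments.
Unset Strict Implicit.
Unset Printing Implicit Defensive.

Import Order.TTheory GRing.Theory Num.Theory.
Local Open Scope ring_scope.

(** Call a matrix with orthonormal columns a frame, and write X_1, X_2 for the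
first and the remaining columns of an orthogonal matrix X.

The singular values are accessed through the Courant-Fischer principle: if j
is positive and at most the number of columns of X, then [sigma X j] is the
largest s such that |X u| >= s |u| on some space of dimension j.  One half of
it, [sigma_attained], exhibits such a space, and the other, [sigma_ge], says
that no space does better.  Both come from a diagonalization of the Gram
matrix, obtained in [real_spectral].  They yield that multiplication by a
contraction on either side does not increase singular values ([sigma_mull],
[sigma_mulr]), Weyl's inequality for a perturbation of small rank
([sigma_weyl]), and sigma_j(XY) >= sigma_j(X) sigma_k(Y) when k is the inner
dimension ([sigma_mul_ge]).

As V_1 = V'_1 R'_11 and V_2 = V'_2, the factorization AV = QR says that
A V'_1 = Q_1 (R_11 R'_11^-1), hence Q_2^T A V'_1 = 0, and that
Q_2^T A V'_2 = R_22.  Therefore A - Q_1 Q_1^T A = Q_2 R_22 V'_2^T, which has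
the singular values of R_22; and R_11 R'_11^-1 = Q_1^T A V'_1 is a compression
of Q_1 Q_1^T A, which in turn is a contraction of A.  The lower bound for
R_11 R'_11^-1 follows from the inequality for products, because the first k
rows of P^T A V'_1 form the product of diag(sigma_1, ..., sigma_k) and
(S^T V')_11.

The upper bounds for R_22 rest on [projected_factor].  Since Q_2^T annihilates
A V_1, it annihilates A V_1 Y where Y is the pseudo-inverse of
M_11 = S_1^T V_1, and S_1^T V_1 Y = 1.  Subtracting A V_1 Y S_1^T from A
removes the part of A on the leading singular vectors and leaves
Q_2^T A = Q_2^T P_2 Sigma_2 (S_2^T - W S_1^T) with W = M_21 M_11^+.  For the
bounds with an index j, the j - 1 largest singular values of Sigma_2 are split
off: they form a matrix of rank j - 1, which Weyl's inequality absorbs by a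
shift of the index by j - 1.  After a cyclic renumbering of the last rows and
columns, the rest of Sigma_2 is Sigma_(j,2), and renumbering the last columns
of S in the same way gives the orthogonal matrix of the statement; it does not
depend on V.  So the singular values of R_22 from the j-th on are bounded by
those of Z = F S'_2^T - F W S'_1^T with F = Sigma_(j,2)
([sigma_trailing_block_le]).  The columns of S'_1 and S'_2 are orthonormal, so
|Z|_F^2 = |F|_F^2 + |F W|_F^2 and, by the Cauchy-Schwarz inequality,
|Z|_2^2 <= |F|_2^2 + |F W|_2^2. *)

(** * The squared Frobenius norm *)

Section SqNorm.
Variable K : realType.

(** Defined as a trace, so that invariance under orthogonal factors and the sum
of the squared singular values are instances of cyclicity. *)
Definition sqnorm m n (X : 'M[K]_(m, n)) : K := \tr (X *m X^T).

Lemma sqnormE m n (X : 'M[K]_(m, n)) : sqnorm X = \sum_i \sum_j X i j ^+ 2.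
Proof.
apply: eq_bigr => i _; rewrite mxE; apply: eq_bigr => j _.
by rewrite mxE expr2.
Qed.

Lemma sqnorm_ge0 m n (X : 'M[K]_(m, n)) : 0 <= sqnorm X.
Proof.
by rewrite sqnormE; apply: sumr_ge0 => i _; apply: sumr_ge0 => j _; rewrite sqr_ge0.
Qed.

Lemma sqnorm_eq0 m n (X : 'M[K]_(m, n)) : (sqnorm X == 0) = (X == 0).
Proof.
apply/idP/eqP => [|->]; last by rewrite /sqnorm mul0mx mxtrace0.
rewrite sqnormE psumr_eq0 => [/allP X0|i _]; last first.
  by apply: sumr_ge0 => j _; rewrite sqr_ge0.
apply/matrixP => i j; rewrite mxE; move: (X0 i (mem_index_enum i)) => /=.
rewrite psumr_eq0 => [/allP Xi0|? _]; last by rewrite sqr_ge0.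
by move: (Xi0 j (mem_index_enum j)); rewrite /= sqrf_eq0 => /eqP.
Qed.

Lemma sqnorm_gt0 m n (X : 'M[K]_(m, n)) : (0 < sqnorm X) = (X != 0).
Proof. by rewrite lt_neqAle sqnorm_ge0 andbT eq_sym sqnorm_eq0. Qed.

Lemma sqnorm_tr m n (X : 'M[K]_(m, n)) : sqnorm X^T = sqnorm X.
Proof. by rewrite /sqnorm trmxK mxtrace_mulC. Qed.

Lemma frobenius_normE m n (X : 'M[K]_(m, n)) :
  frobenius_norm X = Num.sqrt (sqnorm X).
Proof. by rewrite sqnormE. Qed.

Lemma frobenius_norm_sqr m n (X : 'M[K]_(m, n)) :
  frobenius_norm X ^+ 2 = sqnorm X.
Proof. by rewrite frobenius_normE sqr_sqrtr ?sqnorm_ge0. Qed.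

Lemma rv_sqnorm n (u : 'rV[K]_n) : u *m u^T = (sqnorm u)%:M.
Proof. by rewrite [LHS]mx11_scalar /sqnorm /mxtrace big_ord1. Qed.

End SqNorm.

(** * Orthogonal diagonalization of real symmetric matrices *)

Section RealSpectral.
Variable K : realType.

(** A complex eigenvalue a + bi exists because [K] has an algebraically closed
extension.  If x + iy is an eigenvector, evaluating the symmetric form at
(x, y) in the two orders gives b (|x|^2 + |y|^2) = 0, so the eigenvalue is
real, and whichever of x and y is nonzero is a real eigenvector. *)
Lemma symmetric_eigenvector n (G : 'M[K]_n) : (0 < n)%N -> G^T = G ->
  exists (a : K) (v : 'rV[K]_n), v != 0 /\ v *m G = a *: v.
Proof.
move=> n_gt0 Gsym; pose GC := map_mx (real_complex K) G.
have [z /eigenvalueP[v vG v0]] := eigenvalue_closed GC n_gt0.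
pose x := map_mx (@complex.Re K) v; pose y := map_mx (@complex.Im K) v.
case: z vG => a b vG.
have xG : x *m G = a *: x - b *: y.
  apply/rowP => j; move/rowP/(_ j)/(congr1 (@complex.Re K)): vG.
  rewrite !mxE raddf_sum /=; case: (v 0 j) => c d /= <-.
  by apply: eq_bigr => i _; rewrite !mxE; case: (v 0 i) => ? ? /=; ring.
have yG : y *m G = a *: y + b *: x.
  apply/rowP => j; move/rowP/(_ j)/(congr1 (@complex.Im K)): vG.
  rewrite !mxE raddf_sum /=; case: (v 0 j) => c d /= <-.
  by apply: eq_bigr => i _; rewrite !mxE; case: (v 0 i) => ? ? /=; ring.
have xy0 : (x != 0) || (y != 0).
  apply: contraNT v0; rewrite negb_or !negbK => /andP[/eqP x0 /eqP y0].
  apply/eqP/rowP => j; move/rowP/(_ j): x0; move/rowP/(_ j): y0.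
  by rewrite !mxE; case: (v 0 j) => c d /= -> ->.
have b0 : b = 0.
  have sym : x *m G *m y^T = (y *m G *m x^T)^T.
    by rewrite !trmx_mul Gsym trmxK mulmxA.
  have : b * (sqnorm x + sqnorm y) = 0.
    have xyT : x *m y^T = (y *m x^T)^T by rewrite trmx_mul trmxK.
    have /matrixP/(_ 0 0) := sym.
    rewrite xG yG mulmxBl mulmxDl -!scalemxAl !rv_sqnorm xyT.
    rewrite !mxE /= !mulr1n => e; lra.
  move/eqP; rewrite mulf_eq0 => /orP[/eqP //|].
  by rewrite paddr_eq0 ?sqnorm_ge0 // !sqnorm_eq0 -[_ && _]negbK negb_and xy0.
rewrite b0 !scale0r subr0 in xG; rewrite b0 !scale0r addr0 in yG.
by case/orP: xy0 => ?; [exists a, x | exists a, y].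
Qed.

(** The Householder reflection in the hyperplane orthogonal to e - v; it
provides an orthogonal matrix with a prescribed first row without a
Gram-Schmidt process. *)
Lemma reflection_onto n (e v : 'rV[K]_n) : sqnorm e = 1 -> sqnorm v = 1 ->
  exists H : 'M[K]_n, orthogonal_mx H /\ e *m H = v.
Proof.
move=> e1 v1; have [->|ev] := eqVneq e v.
  by exists 1%:M; rewrite /orthogonal_mx trmx1 !mulmx1.
pose w := e - v; pose c := 2 / sqnorm w.
have w0 : sqnorm w != 0 by rewrite sqnorm_eq0 subr_eq0.
have ew : e *m w^T = (sqnorm w / 2)%:M.
  rewrite /w; have -> : (e - v)^T = e^T - v^T by apply/matrixP => i j; rewrite !mxE.
  have -> : sqnorm (e - v) = 2 - 2 * (e *m v^T) 0 0.
    have : sqnorm (e - v) = ((e - v) *m (e - v)^T) 0 0.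
      by rewrite rv_sqnorm mxE eqxx.
    have -> : (e - v)^T = e^T - v^T by apply/matrixP => i j; rewrite !mxE.
    rewrite mulmxBl !mulmxBr !rv_sqnorm.
    have -> : v *m e^T = (e *m v^T)^T by rewrite trmx_mul trmxK.
    rewrite e1 v1 !mxE /= => ->; rewrite !mulr1n; ring.
  rewrite mulmxBr rv_sqnorm e1 [e *m _ in LHS]mx11_scalar -raddfB /=.
  by congr (_%:M); field.
have wE : e - w = v by rewrite /w opprB addrC subrK.
rewrite /c; clearbody w; clear c; set c := 2 / sqnorm w.
exists (1%:M - c *: (w^T *m w)); split; last first.
  rewrite mulmxBr mulmx1 -scalemxAr mulmxA ew mul_scalar_mx scalerA.
  have -> : c * (sqnorm w / 2) = 1 by rewrite /c; field.
  by rewrite scale1r.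
have Ht : (1%:M - c *: (w^T *m w))^T = 1%:M - c *: (w^T *m w).
  by rewrite linearB /= linearZ /= trmx1 trmx_mul trmxK.
rewrite /orthogonal_mx Ht mulmxBl mul1mx !mulmxBr mulmx1 -!scalemxAl -!scalemxAr.
have -> : w^T *m w *m (w^T *m w) = sqnorm w *: (w^T *m w).
  by rewrite -mulmxA [w *m (_ *m _)]mulmxA rv_sqnorm mul_scalar_mx -scalemxAr.
rewrite !scalerA.
have -> : c * c * sqnorm w = c + c by rewrite /c; field.
rewrite scalerDl; set T := c *: _.
have -> : T - (T + T) = - T by rewrite opprD addrA subrr add0r.
by rewrite opprK subrK.
Qed.

(** A reflection that sends the first basis vector to a unit eigenvector
conjugates [G] to a block diagonal matrix with a 1 x 1 block, which reduces the
claim to the other block. *)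
Lemma real_spectral n (G : 'M[K]_n) : G^T = G ->
  exists (S : 'M[K]_n) (d : 'rV[K]_n),
    orthogonal_mx S /\ G = S *m diag_mx d *m S^T.
Proof.
elim: n G => [|n IHn]; first by exists 1%:M, 0; split; apply/matrixP => [[]].
rewrite -add1n => G Gsym.
have [a [v [v0 vG]]] := symmetric_eigenvector (isT : (0 < 1 + n)%N) Gsym.
pose e : 'rV[K]_(1 + n) := delta_mx 0 0.
have e1 : sqnorm e = 1.
  rewrite /sqnorm /e trmx_delta mul_delta_mx /mxtrace big_ord1 mxE.
  by rewrite !eqxx.
pose v' := (Num.sqrt (sqnorm v))^-1 *: v.
have v'1 : sqnorm v' = 1.
  rewrite /v' /sqnorm linearZ /= -scalemxAl -scalemxAr scalerA linearZ /=.
  rewrite -/(sqnorm v) -invfM -expr2 sqr_sqrtr ?sqnorm_ge0 //.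
  by rewrite mulVf // sqnorm_eq0.
have v'G : v' *m G = a *: v'.
  by rewrite /v' -scalemxAl vG !scalerA mulrC.
have [H [Horth eH]] := reflection_onto e1 v'1.
have HHt : H *m H^T = 1%:M by apply: mulmx1C.
pose M := H *m G *m H^T.
have Msym : M^T = M by rewrite /M !trmx_mul trmxK Gsym mulmxA.
have eM : e *m M = a *: e.
  by rewrite /M !mulmxA eH v'G -scalemxAl -eH -mulmxA HHt mulmx1.
have GE : G = H^T *m M *m H.
  by rewrite /M !mulmxA Horth mul1mx -mulmxA Horth mulmx1.
clearbody M.
have M0 j : M 0 j = a * (j == 0)%:R.
  move/rowP/(_ j): eM; rewrite !mxE eqxx /= => <-.
  rewrite (bigD1 0) //= mxE !eqxx mul1r big1 ?addr0 // => i /negPf i0.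
  by rewrite mxE i0 andbF mul0r.
have M0' i : M i 0 = a * (i == 0)%:R by rewrite -Msym mxE M0.
pose M' : 'M[K]_n := drsubmx M.
have M'sym : M'^T = M' by rewrite /M' trmx_drsub Msym.
have [S' [d' [S'orth M'E]]] := IHn M' M'sym.
have ME : M = block_mx (a%:M : 'M_1) 0 0 M' :> 'M_(1 + n).
  rewrite -[LHS]submxK -/M'; congr block_mx.
  - by apply/matrixP => i j; rewrite !ord1 !mxE !lshift0 M0 eqxx mulr1.
  - by apply/matrixP => i j; rewrite !ord1 !mxE !lshift0 M0 mulr0.
  - by apply/matrixP => i j; rewrite !ord1 !mxE !lshift0 M0' mulr0.
pose B : 'M[K]_(1 + n) := block_mx 1%:M 0 0 S'.
have Borth : B^T *m B = 1%:M.
  rewrite /B tr_block_mx !trmx0 trmx1 mulmx_block S'orth.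
  rewrite !mulmx0 !mul0mx mulmx1 !addr0 add0r.
  by rewrite [RHS](scalar_mx_block 1 n 1).
exists (H^T *m B), (row_mx (a%:M : 'M_1) d').
split; first by rewrite /orthogonal_mx trmx_mul trmxK mulmxA -(mulmxA _ H) HHt mulmx1.
rewrite GE trmx_mul trmxK !mulmxA; congr (_ *m _).
rewrite -!mulmxA; congr (_ *m _).
rewrite ME M'E /B tr_block_mx !trmx0 trmx1 diag_mx_row.
rewrite !mulmx_block.
rewrite !mulmx0 !mul0mx !mulmx1 !mul1mx !addr0 !add0r !mulmxA.
rewrite mulmx0; congr (block_mx _ _ _ _); by apply/matrixP => i j; rewrite !ord1 !mxE ?eqxx.
Qed.

End RealSpectral.

(** * The spectrum of the Gram matrix *)

Section GramSpectrum.
Variable K : realType.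

Definition seq_diag n (s : seq K) : 'M[K]_n := diag_mx (\row_(i < n) s`_i).

Lemma orthogonal_mxC n (X : 'M[K]_n) : orthogonal_mx X -> X *m X^T = 1%:M.
Proof. exact: mulmx1C. Qed.

Lemma char_poly_orthogonal_conj n (S X : 'M[K]_n) : orthogonal_mx S ->
  char_poly (S *m X *m S^T) = char_poly X.
Proof.
move=> /orthogonal_mxC SSt; pose SP := map_mx polyC S.
have SPSPt : SP *m SP^T = 1%:M by rewrite /SP map_trmx -map_mxM SSt map_mx1.
rewrite /char_poly; have -> : char_poly_mx (S *m X *m S^T) =
    SP *m char_poly_mx X *m SP^T.
  rewrite /char_poly_mx mulmxBr mulmxBl !map_mxM -map_trmx mul_mx_scalar -/SP.
  by rewrite -scalemxAl SPSPt scalemx1.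
by rewrite !det_mulmx mulrAC -det_mulmx SPSPt det1 mul1r.
Qed.

Lemma char_poly_seq_diag n (s : seq K) : size s = n ->
  char_poly (seq_diag n s) = \prod_(x <- s) ('X - x%:P).
Proof.
move=> <-; rewrite char_poly_trig ?diag_mx_is_trig // (big_nth 0) big_mkord.
by apply: eq_bigr => i _; rewrite !mxE eqxx.
Qed.

(** The characteristic polynomial determines its sequence of roots up to order,
and sorting fixes the order: the choice made in [gram_eigenvalues] agrees with
any sorted diagonalization. *)
Lemma gram_eigenvalues_unique m n (X : 'M[K]_(m, n)) (S : 'M[K]_n) (s : seq K) :
  size s = n -> sorted >=%R s -> orthogonal_mx S ->
  X^T *m X = S *m seq_diag n s *m S^T -> gram_eigenvalues X = s.
Proof.
move=> ss s_sorted Sorth XE; apply: xget_unique.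
  by rewrite /= XE char_poly_orthogonal_conj // char_poly_seq_diag.
move=> t /= [tE t_sorted]; move: tE.
rewrite XE char_poly_orthogonal_conj // char_poly_seq_diag // => /prod_XsubC_eq st.
apply: (sorted_eq ge_trans ge_anti) => //.
by rewrite perm_sym.
Qed.

Lemma sorted_spectral n (G : 'M[K]_n) : G^T = G ->
  exists (S : 'M[K]_n) (s : seq K), [/\ size s = n, sorted >=%R s,
    orthogonal_mx S & G = S *m seq_diag n s *m S^T].
Proof.
move=> /real_spectral[S [d [Sorth GE]]].
pose t := [tuple d 0 i | i < n].
have /tuple_permP[p sE] : perm_eq (sort >=%R t) t by rewrite perm_sort.
exists (col_perm p S), (sort >=%R t); split.
- by rewrite size_sort size_tuple.
- exact/sort_sorted/ge_total.
- rewrite /orthogonal_mx col_permE trmx_mul mulmxA -(mulmxA _ S^T) Sorth mulmx1.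
  by rewrite tr_perm_mx invgK -perm_mxM mulgV perm_mx1.
- have sn (i : 'I_n) : (sort >=%R t)`_i = d 0 (p i).
    by rewrite sE -tnth_nth !tnth_mktuple.
  apply/matrixP => i j; rewrite GE !mxE (reindex_inj (@perm_inj _ p)) /=.
  apply: eq_bigr => k _; rewrite !mxE (bigD1 (p k)) //= big1 => [|l lk].
    rewrite [in RHS](bigD1 k) //= big1 => [|l lk].
      by rewrite !mxE !eqxx !mulr1n !addr0 sn.
    by rewrite !mxE (negPf lk) mulr0n mulr0.
  by rewrite !mxE (negPf lk) mulr0n mulr0.
Qed.

Lemma sqnorm_diag_form m n (X : 'M[K]_(m, n)) (S : 'M[K]_n) (s : seq K)
    (u : 'rV[K]_n) : X^T *m X = S *m seq_diag n s *m S^T ->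
  sqnorm (u *m X^T) = \sum_(i < n) s`_i * (u *m S) 0 i ^+ 2.
Proof.
move=> XE; rewrite /sqnorm trmx_mul trmxK mulmxA -(mulmxA u) XE.
have -> : u *m (S *m seq_diag n s *m S^T) *m u^T =
    (u *m S) *m seq_diag n s *m (u *m S)^T by rewrite trmx_mul !mulmxA.
rewrite /mxtrace big_ord1 mxE; apply: eq_bigr => i _.
rewrite mxE (bigD1 i) //= big1 => [|j ji]; last by rewrite !mxE (negPf ji) mulr0n mulr0.
by rewrite [diag_mx _ _ _]mxE [(_)^T _ _]mxE [(\row__ _) _ _]mxE eqxx mulr1n addr0; ring.
Qed.

Lemma gram_spectral m n (X : 'M[K]_(m, n)) :
  let s := gram_eigenvalues X in
  exists S : 'M[K]_n, [/\ size s = n, sorted >=%R s, forall i, 0 <= s`_i,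
    orthogonal_mx S & X^T *m X = S *m seq_diag n s *m S^T].
Proof.
have [|S [s [ss s_sorted Sorth XE]]] := @sorted_spectral n (X^T *m X).
  by rewrite trmx_mul trmxK.
rewrite /= (gram_eigenvalues_unique ss s_sorted Sorth XE).
exists S; split=> // i.
have [ni|iln] := leqP n i; first by rewrite nth_default // ss.
have := sqnorm_ge0 ((delta_mx 0 (Ordinal iln) : 'rV_n) *m S^T *m X^T).
rewrite (sqnorm_diag_form _ XE) -mulmxA Sorth mulmx1.
rewrite (bigD1 (Ordinal iln)) //= big1 => [|j ji].
  by rewrite !mxE !eqxx expr1n mulr1 addr0.
by rewrite !mxE (negPf ji) andbF expr0n mulr0.
Qed.

Lemma sigma_ge0 m n (X : 'M[K]_(m, n)) j : 0 <= sigma X j.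
Proof. exact: sqrtr_ge0. Qed.

Lemma sigma_sqr m n (X : 'M[K]_(m, n)) j :
  sigma X j ^+ 2 = (gram_eigenvalues X)`_j.-1.
Proof. by have [S [_ _ s0 _ _]] := gram_spectral X; rewrite sqr_sqrtr. Qed.

Lemma size_gram_eigenvalues m n (X : 'M[K]_(m, n)) : size (gram_eigenvalues X) = n.
Proof. by have [S []] := gram_spectral X. Qed.

Lemma sigma_oversize m n (X : 'M[K]_(m, n)) j : (n < j)%N -> sigma X j = 0.
Proof.
by case: j => // j nj; rewrite /sigma nth_default ?sqrtr0 // size_gram_eigenvalues.
Qed.

Lemma sigma_opp m n (X : 'M[K]_(m, n)) j : sigma (- X) j = sigma X j.
Proof.
by rewrite /sigma /gram_eigenvalues [(- _)^T]linearN /= mulNmx mulmxN opprK.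
Qed.

Lemma sum_sigma_sqr m n (X : 'M[K]_(m, n)) :
  sqnorm X = \sum_(i < n) sigma X i.+1 ^+ 2.
Proof.
have [S [_ _ _ Sorth XE]] := gram_spectral X.
rewrite /sqnorm mxtrace_mulC XE -mulmxA mxtrace_mulC -mulmxA Sorth mulmx1.
by rewrite mxtrace_diag; apply: eq_bigr => i _; rewrite sigma_sqr mxE.
Qed.

Lemma sqnorm_isometry m n p (X : 'M[K]_(p, n)) (F : 'M[K]_(m, n)) :
  F^T *m F = 1%:M -> sqnorm (X *m F^T) = sqnorm X.
Proof. by move=> FF; rewrite /sqnorm trmx_mul trmxK mulmxA -(mulmxA X) FF mulmx1. Qed.

Lemma sqnorm_coisometry m n p (X : 'M[K]_(p, m)) (F : 'M[K]_(m, n)) :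
  F *m F^T = 1%:M -> sqnorm (X *m F) = sqnorm X.
Proof. by move=> FF; rewrite -[F]trmxK sqnorm_isometry // trmxK. Qed.

(** * The Courant-Fischer principle *)

(** The space is spanned by eigenvectors of the Gram matrix for its [j] largest
eigenvalues.  Vectors are rows throughout, so X acts by right multiplication
by its transpose. *)
Lemma sigma_attained m n (X : 'M[K]_(m, n)) j : (0 < j <= n)%N ->
  exists U : 'M[K]_(j, n), U *m U^T = 1%:M /\
    forall u : 'rV_j, sigma X j ^+ 2 * sqnorm u <= sqnorm (u *m U *m X^T).
Proof.
case/andP=> j0 jn; have [S [ss s_sorted s0 Sorth XE]] := gram_spectral X.
exists (rowsub (widen_ord jn) S^T); split.
  have -> : rowsub (widen_ord jn) S^T = rowsub (widen_ord jn) 1%:M *m S^T.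
    by rewrite mul_rowsub_mx mul1mx.
  rewrite trmx_mul trmxK mulmxA -(mulmxA _ S^T) Sorth mulmx1.
  apply/matrixP => a b; rewrite !mxE (bigD1 (widen_ord jn a)) //= big1 => [|c].
    by rewrite !mxE eqxx mul1r addr0 eq_sym.
  by rewrite !mxE eq_sym => /negPf ->; rewrite mul0r.
move=> u; rewrite (sqnorm_diag_form _ XE).
pose U : 'M[K]_(j, n) := rowsub (widen_ord jn) 1%:M.
have -> : u *m rowsub (widen_ord jn) S^T *m S = u *m U.
  by rewrite -{1}[S^T]mul1mx -mul_rowsub_mx -!mulmxA Sorth mulmx1.
have -> : sqnorm u = sqnorm (u *m U).
  rewrite /sqnorm trmx_mul mulmxA -(mulmxA u).
  suff -> : U *m U^T = 1%:M by rewrite mulmx1.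
  rewrite /U mul_rowsub_mx mul1mx; apply/matrixP => a b.
  by rewrite !mxE -!val_eqE /= eq_sym.
rewrite sqnormE big_ord1 mulr_sumr; apply: ler_sum => i _.
have [ij|ji] := ltnP i j; last first.
  suff -> : (u *m U) 0 i = 0 by rewrite expr0n !mulr0.
  rewrite mxE big1 // => k _; rewrite !mxE -val_eqE /=.
  by rewrite (ltn_eqF (leq_trans (ltn_ord k) ji)) mulr0.
apply: ler_wpM2r; first exact: sqr_ge0.
rewrite sigma_sqr; apply: (sorted_leq_nth ge_trans ge_refl 0 s_sorted).
- by rewrite inE ss.
- by rewrite inE ss prednK.
- by rewrite -ltnS prednK.
Qed.

(** The row space of [U] has dimension [j], so it contains a nonzero vector
orthogonal to the first [j.-1] eigenvectors, on which the form is at most the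
[j]-th eigenvalue. *)
Lemma sigma_ge m n (X : 'M[K]_(m, n)) j (U : 'M[K]_(j, n)) c :
  (0 < j)%N -> row_free U ->
  (forall u : 'rV_j, c * sqnorm (u *m U) <= sqnorm (u *m U *m X^T)) ->
  c <= sigma X j ^+ 2.
Proof.
move=> j0 Ufree Uc; have [S [ss s_sorted s0 Sorth XE]] := gram_spectral X.
have jn : (j <= n)%N by rewrite -(eqP Ufree) rank_leq_col.
have j1n : (j.-1 <= n)%N by apply: leq_trans jn; apply: leq_pred.
pose T := U *m S *m (rowsub (widen_ord j1n) 1%:M)^T.
have /rowV0Pn[u uT u0] : kermx T != 0.
  rewrite kermx_eq0; apply/negP => /eqP Tj.
  by have := rank_leq_col T; rewrite Tj leqNgt prednK // leqnn.
have w0 (i : 'I_n) : (i < j.-1)%N -> (u *m U *m S) 0 i = 0.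
  move=> ij; move/sub_kermxP/rowP/(_ (Ordinal ij)): uT; rewrite /T !mulmxA !mxE.
  rewrite (bigD1 i) //= big1 => [|k ki]; last first.
    by rewrite !mxE -val_eqE /= eq_sym (negPf (ki : k != i :> nat)) mulr0.
  by rewrite !mxE -val_eqE eqxx mulr1 addr0.
have uU0 : u *m U != 0 by rewrite mulmx_free_eq0.
rewrite -(ler_pM2r (_ : 0 < sqnorm (u *m U))) ?sqnorm_gt0 //.
apply: (le_trans (Uc u)); rewrite (sqnorm_diag_form _ XE).
have -> : sqnorm (u *m U) = sqnorm (u *m U *m S).
  by rewrite [RHS]sqnorm_coisometry // orthogonal_mxC.
rewrite [sqnorm _]sqnormE big_ord1 mulr_sumr; apply: ler_sum => i _.
have [ij|ji] := ltnP i j.-1; first by rewrite w0 // expr0n !mulr0.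
apply: ler_wpM2r; first exact: sqr_ge0.
rewrite sigma_sqr; apply: (sorted_leq_nth ge_trans ge_refl 0 s_sorted) => //.
- by rewrite inE ss prednK.
- by rewrite inE ss.
Qed.

(** * Contractions, low rank perturbations and products *)

Definition contraction m n (Z : 'M[K]_(m, n)) :=
  forall u : 'rV[K]_m, sqnorm (u *m Z) <= sqnorm u.

Lemma contraction_frame_tr m n (F : 'M[K]_(m, n)) :
  F^T *m F = 1%:M -> contraction F^T.
Proof. by move=> FF u; rewrite sqnorm_isometry. Qed.

(** F F^T is an orthogonal projection: |u|^2 - |u F|^2 = |u - u F F^T|^2. *)
Lemma contraction_frame m n (F : 'M[K]_(m, n)) :
  F^T *m F = 1%:M -> contraction F.
Proof.
move=> FF u; rewrite -subr_ge0.
suff -> : sqnorm u - sqnorm (u *m F) = sqnorm (u - u *m F *m F^T).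
  exact: sqnorm_ge0.
rewrite /sqnorm linearB /= mulmxBl !mulmxBr !trmx_mul !trmxK !mulmxA.
by rewrite -(mulmxA _ F^T F) FF mulmx1 subrr subr0 linearB.
Qed.

Lemma sigma_mono m1 m2 n (X : 'M[K]_(m1, n)) (Y : 'M[K]_(m2, n)) j :
  (0 < j)%N -> (forall u : 'rV_n, sqnorm (u *m X^T) <= sqnorm (u *m Y^T)) ->
  sigma X j <= sigma Y j.
Proof.
move=> j0 XY; have [jn|nj] := leqP j n; last by rewrite !sigma_oversize.
have [|U [UU UX]] := @sigma_attained _ _ X j; first by rewrite j0.
rewrite -ler_sqr ?nnegrE ?sigma_ge0 //; apply: (sigma_ge (U := U)) => //.
  by apply/row_freeP; exists U^T.
move=> u; apply: le_trans (XY _); apply: le_trans (UX u).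
by rewrite sqnorm_coisometry.
Qed.

Lemma sigma_mull m n p (Z : 'M[K]_(p, m)) (X : 'M[K]_(m, n)) j :
  (0 < j)%N -> contraction Z^T -> sigma (Z *m X) j <= sigma X j.
Proof.
by move=> j0 Zc; apply: sigma_mono => // u; rewrite trmx_mul mulmxA.
Qed.

(** A space on which X Z expands by a positive factor is mapped injectively by
Z, onto a space on which X expands at least as much; this makes sense only if
the singular value is nonzero, whence the case distinction. *)
Lemma sigma_mulr m n p (X : 'M[K]_(m, n)) (Z : 'M[K]_(n, p)) j :
  (0 < j)%N -> contraction Z^T -> sigma (X *m Z) j <= sigma X j.
Proof.
move=> j0 Zc; have [s0|s_neq0] := eqVneq (sigma (X *m Z) j) 0.
  by rewrite s0 sigma_ge0.
have jp : (j <= p)%N by rewrite leqNgt; apply: contra s_neq0 => /sigma_oversize ->.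
have [|U [UU UX]] := @sigma_attained _ _ (X *m Z) j; first by rewrite j0.
have s_gt0 : 0 < sigma (X *m Z) j ^+ 2.
  by rewrite exprn_gt0 // lt_neqAle eq_sym s_neq0 sigma_ge0.
rewrite -ler_sqr ?nnegrE ?sigma_ge0 //; apply: (sigma_ge (U := U *m Z^T)) => //.
  apply: inj_row_free => u uUZ; apply/eqP; rewrite -sqnorm_eq0.
  have := UX u; rewrite trmx_mul mulmxA -(mulmxA u U) uUZ mul0mx.
  rewrite [X in _ <= X]/sqnorm mul0mx mxtrace0 pmulr_rle0 // => su.
  by rewrite eq_le su sqnorm_ge0.
move=> u; rewrite mulmxA; apply: le_trans (_ : sigma (X *m Z) j ^+ 2 * sqnorm u <= _).
  rewrite ler_pM2l //; apply: le_trans (Zc _) _.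
  by rewrite sqnorm_coisometry.
by have := UX u; rewrite trmx_mul mulmxA.
Qed.

(** In a space of dimension i + r where X expands by sigma_(i+r)(X), the kernel
of B has dimension at least i, and there X and X - B agree. *)
Lemma sigma_weyl m n (X B : 'M[K]_(m, n)) r i : (0 < i)%N -> (\rank B <= r)%N ->
  sigma X (i + r) <= sigma (X - B) i.
Proof.
move=> i0 rB; have [irn|nir] := leqP (i + r) n; last first.
  by rewrite sigma_oversize // sigma_ge0.
have [|U [UU UX]] := @sigma_attained _ _ X (i + r); first by rewrite addn_gt0 i0.
pose N := kermx (U *m B^T).
have iN : (i <= \rank N)%N.
  have : (\rank (U *m B^T) <= r)%N.
    by rewrite (leq_trans (mxrankM_maxr _ _)) // mxrank_tr.
  by rewrite mxrank_ker; lia.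
pose W : 'M[K]_(i, i + r) := (pid_mx i : 'M_(i, \rank N)) *m row_base N.
have Wfree : row_free W.
  by rewrite /row_free mxrankMfree ?row_base_free // rank_pid_mx.
have WUB : W *m U *m B^T = 0.
  rewrite -mulmxA; apply/sub_kermxP; rewrite -/N.
  by apply: submx_trans (submxMl _ _) _; rewrite eq_row_base.
rewrite -ler_sqr ?nnegrE ?sigma_ge0 //; apply: (sigma_ge (U := W *m U)) => //.
  by rewrite /row_free mxrankMfree //; apply/row_freeP; exists U^T.
move=> u; rewrite linearB /= mulmxBr -(mulmxA u _ B^T) WUB mulmx0 subr0.
by have := UX (u *m W); rewrite (mulmxA u) [sqnorm (_ *m U)]sqnorm_coisometry.
Qed.

Lemma sigma1_le m n (X : 'M[K]_(m, n)) c :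
  0 <= c -> (forall u : 'rV_n, sqnorm (u *m X^T) <= c * sqnorm u) ->
  sigma X 1 ^+ 2 <= c.
Proof.
move=> c0 Xc; case: n X Xc => [|n] X Xc.
  by rewrite sigma_oversize // expr0n.
have [|U [UU UX]] := @sigma_attained _ _ X 1; first by [].
have := le_trans (UX 1%:M) (Xc _); rewrite mul1mx.
have -> : sqnorm U = 1 by rewrite /sqnorm UU mxtrace1.
by rewrite /sqnorm trmx1 mulmx1 mxtrace1 !mulr1.
Qed.

(** If sigma_k(Y) is nonzero, Y maps some space of dimension k isomorphically
onto the whole inner space; the optimal space for X is pulled back along this
isomorphism. *)
Lemma sigma_mul_ge m k n (X : 'M[K]_(m, k)) (Y : 'M[K]_(k, n)) j :
  (0 < j <= k)%N -> sigma X j * sigma Y k <= sigma (X *m Y) j.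
Proof.
case/andP=> j0 jk; have k0 := leq_trans j0 jk.
have [->|s_neq0] := eqVneq (sigma Y k) 0; first by rewrite mulr0 sigma_ge0.
have kn : (k <= n)%N by rewrite leqNgt; apply: contra s_neq0 => /sigma_oversize ->.
have s_gt0 : 0 < sigma Y k ^+ 2.
  by rewrite exprn_gt0 // lt_neqAle eq_sym s_neq0 sigma_ge0.
have [|U [UU UY]] := @sigma_attained _ _ Y k; first by rewrite k0.
have [|V [VV VX]] := @sigma_attained _ _ X j; first by rewrite j0.
(* [T] is the matrix of Y on the row space of [U]. *)
pose T := U *m Y^T.
have Tunit : T \in unitmx.
  rewrite -row_free_unit; apply: inj_row_free => u uT; apply/eqP.
  have := UY u; rewrite -sqnorm_eq0 -mulmxA uT [X in _ <= X]/sqnorm mul0mx mxtrace0.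
  by rewrite pmulr_rle0 // => su; rewrite eq_le su sqnorm_ge0.
have Vfree : row_free V by apply/row_freeP; exists V^T.
rewrite -ler_sqr ?nnegrE ?mulr_ge0 ?sigma_ge0 // exprMn.
apply: (sigma_ge (U := V *m invmx T *m U)) => //.
  rewrite /row_free mxrankMfree; last by apply/row_freeP; exists U^T.
  by rewrite mxrankMfree // row_free_unit unitmx_inv.
move=> u; set v := u *m V *m invmx T.
have -> : u *m (V *m invmx T *m U) = v *m U by rewrite /v !mulmxA.
have -> : sqnorm (v *m U) = sqnorm v.
  by rewrite sqnorm_coisometry.
have vT : v *m T = u *m V by rewrite /v mulmxKV.
have -> : v *m U *m (X *m Y)^T = u *m V *m X^T.
  by rewrite trmx_mul -vT /T !mulmxA.
apply: le_trans (VX u); rewrite -mulrA ler_wpM2l ?sqr_ge0 //.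
have -> : sqnorm u = sqnorm (v *m T).
  by rewrite vT sqnorm_coisometry.
by rewrite /T mulmxA.
Qed.

(** * Singular values and distances read off an SVD *)

Lemma sigma_of_svd m n (X : 'M[K]_(m, n)) P S (s : nat -> K) i :
  orthogonal_mx P -> orthogonal_mx S -> (forall i, 0 <= s i) ->
  (forall i j, (i <= j)%N -> s j <= s i) ->
  X = P *m rect_diag m n s *m S^T ->
  sigma X i.+1 = if (i < minn m n)%N then s i else 0.
Proof.
move=> Porth Sorth s0 s_mono XE.
pose t := mkseq (fun i => if (i < m)%N then s i ^+ 2 else 0) n.
have tE : gram_eigenvalues X = t.
  apply: (gram_eigenvalues_unique (S := S)); rewrite ?size_mkseq //.
    apply/(sortedP 0) => a; rewrite size_mkseq => an.
    rewrite !nth_mkseq //=; last exact: ltnW.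
    case: ltnP => am; case: ltnP => bm; rewrite ?sqr_ge0 ?lexx //; last first.
      by move: bm; rewrite leqNgt (ltnW am).
    by rewrite ler_sqr ?nnegrE // s_mono.
  rewrite XE !trmx_mul trmxK !mulmxA -(mulmxA _ P^T) Porth mulmx1.
  congr (_ *m _); rewrite -!mulmxA; congr (_ *m _).
  apply/matrixP => a b; rewrite !mxE nth_mkseq //.
  have [am|ma] := ltnP a m.
    rewrite (bigD1 (Ordinal am)) //= big1 => [|c ca].
      rewrite !mxE eqxx addr0 /= -val_eqE /=.
      by case: eqP => [->|_]; rewrite ?mulr0 ?mulr0n // mulr1n expr2.
    rewrite !mxE (_ : (c == a :> nat) = false) ?mul0r //.
    exact: negPf ca.
  rewrite mul0rn big1 // => c _; rewrite !mxE.
  by rewrite (ltn_eqF (leq_trans (ltn_ord c) ma)) mul0r.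
rewrite /sigma tE /=; have [i_n|ni] := ltnP i n; last first.
  by rewrite nth_default ?size_mkseq // sqrtr0 ltnNge geq_min ni orbT.
rewrite nth_mkseq // leq_min i_n andbT; case: ifP => _; last by rewrite sqrtr0.
by rewrite sqrtr_sqr ger0_norm.
Qed.

Lemma truncated_svd_dist m n r (X Y : 'M[K]_(m, n)) : is_truncated_svd r X Y ->
  sqnorm (X - Y) = \sum_(i < n | (r <= i)%N) sigma X i.+1 ^+ 2.
Proof.
case=> P [D [S [[Porth Sorth [s [s0 s_mono DE]] XE] ->]]].
set D' := \matrix_(i, j) _.
have -> : X - P *m D' *m S^T = P *m (D - D') *m S^T.
  by rewrite XE mulmxBr mulmxBl.
rewrite sqnorm_isometry // -sqnorm_tr trmx_mul -{1}[P]trmxK.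
rewrite sqnorm_isometry ?trmxK ?orthogonal_mxC // sqnorm_tr.
rewrite sqnormE exchange_big /= [RHS]big_mkcond /=; apply: eq_bigr => j _.
rewrite (sigma_of_svd _ Porth Sorth s0 s_mono) -?DE // leq_min ltn_ord andbT.
have [jm|mj] := ltnP j m.
  rewrite (bigD1 (Ordinal jm)) //= big1 => [|i ij].
    rewrite !mxE DE !mxE eqxx addr0 /=.
    by case: leqP => _; rewrite ?subr0 // subrr expr0n.
  rewrite !mxE DE !mxE (_ : (i == j :> nat) = false); last exact: negPf ij.
  by rewrite if_same subrr expr0n.
rewrite expr0n if_same big1 // => i _.
by rewrite !mxE DE !mxE (ltn_eqF (leq_trans (ltn_ord i) mj)) if_same subrr expr0n.
Qed.

(** The passage from Weyl's inequality to the optimality of truncation in the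
Frobenius norm: comparing term by term, the tail of X from index r on is
bounded by all of Y. *)
Lemma sum_sigma_weyl m1 n1 m2 n2 (X : 'M[K]_(m1, n1)) (Y : 'M[K]_(m2, n2)) r :
  (forall i, (0 < i)%N -> sigma X (i + r) <= sigma Y i) ->
  \sum_(i < n1 | (r <= i)%N) sigma X i.+1 ^+ 2 <= sqnorm Y.
Proof.
move=> XY; rewrite sum_sigma_sqr.
(* The sum over Y is padded with zeros to cover the tail of X. *)
have -> : \sum_(i < n2) sigma Y i.+1 ^+ 2 =
    \sum_(0 <= i < n1 + n2) sigma Y i.+1 ^+ 2.
  rewrite (big_cat_nat (leq0n n2) (leq_addl n1 n2)) //= [X in _ = _ + X]big_nat_cond.
  rewrite [X in _ = _ + X]big1; last first.
    by move=> i /andP[/andP[ni _] _]; rewrite sigma_oversize ?expr0n // ltnS.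
  by rewrite addr0 big_mkord.
have [rn|nr] := leqP r n1; last first.
  rewrite big1 => [|i ri]; last by have := ltn_ord i; lia.
  by apply: sumr_ge0 => i _; rewrite sqr_ge0.
rewrite -(big_mkord (fun i => (r <= i)%N) (fun i => sigma X i.+1 ^+ 2)).
rewrite (big_cat_nat (leq0n r) rn) //= [X in X + _]big_nat_cond.
rewrite [X in X + _]big1 ?add0r; last by move=> i; lia.
have -> : \sum_(r <= i < n1 | (r <= i)%N) sigma X i.+1 ^+ 2 =
    \sum_(r <= i < n1) sigma X i.+1 ^+ 2.
  by rewrite big_nat_cond [RHS]big_nat_cond; apply: eq_bigl => i; lia.
rewrite -{1}[r]add0n big_addn.
have n12 : (n1 - r <= n1 + n2)%N by lia.
rewrite (big_cat_nat (leq0n _) n12) //= -[X in X <= _]addr0; apply: lerD.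
  apply: ler_sum => i _; rewrite ler_sqr ?nnegrE ?sigma_ge0 //.
  by rewrite -addSn XY.
by apply: sumr_ge0 => i _; rewrite sqr_ge0.
Qed.

(** * Comparison with the spectral norm *)

Lemma sigma_anti m n (X : 'M[K]_(m, n)) i j : (0 < i <= j)%N ->
  sigma X j <= sigma X i.
Proof.
case/andP=> i0 ij; have [S [ss s_sorted s0 _ _]] := gram_spectral X.
have [nj|jn] := ltnP n j; first by rewrite sigma_oversize // sigma_ge0.
rewrite -ler_sqr ?nnegrE ?sigma_ge0 // !sigma_sqr.
by apply: (sorted_leq_nth ge_trans ge_refl 0 s_sorted); rewrite ?inE ?ss; lia.
Qed.

Lemma sqnorm_le_sigma1 m n (X : 'M[K]_(m, n)) (u : 'rV_n) :
  sqnorm (u *m X^T) <= sigma X 1 ^+ 2 * sqnorm u.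
Proof.
have [S [ss s_sorted s0 Sorth XE]] := gram_spectral X.
rewrite (sqnorm_diag_form _ XE) -(sqnorm_coisometry u (orthogonal_mxC Sorth)).
rewrite [sqnorm _]sqnormE big_ord1 mulr_sumr; apply: ler_sum => i _.
apply: ler_wpM2r; first exact: sqr_ge0.
rewrite sigma_sqr; apply: (sorted_leq_nth ge_trans ge_refl 0 s_sorted) => //.
  by rewrite inE ss (leq_trans _ (ltn_ord i)).
by rewrite inE ss.
Qed.

Lemma sqnorm_mul_le m n (X : 'M[K]_(m, n)) (u : 'rV_n) :
  sqnorm (u *m X^T) <= sqnorm X * sqnorm u.
Proof.
apply: le_trans (sqnorm_le_sigma1 _ _) _; apply: ler_wpM2r; first exact: sqnorm_ge0.
case: n X u => [|n] X u; first by rewrite sigma_oversize // expr0n sqnorm_ge0.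
rewrite sum_sigma_sqr (bigD1 ord0) //= lerDl.
by apply: sumr_ge0 => i _; rewrite sqr_ge0.
Qed.

Lemma frobenius_norm_ge0 m n (X : 'M[K]_(m, n)) : 0 <= frobenius_norm X.
Proof. exact: sqrtr_ge0. Qed.

Lemma sqnormZ m n a (X : 'M[K]_(m, n)) : sqnorm (a *: X) = a ^+ 2 * sqnorm X.
Proof.
by rewrite /sqnorm linearZ /= -scalemxAl -scalemxAr scalerA linearZ /= -expr2.
Qed.

(** The Frobenius norm bounds the set that defines the spectral norm, so the
supremum exists and bounds |X v| for the normalization v of [u]. *)
Lemma spectral_normP m n (X : 'M[K]_(m, n)) (u : 'rV_n) :
  sqnorm (u *m X^T) <= spectral_norm X ^+ 2 * sqnorm u.
Proof.
have [->|u0] := eqVneq u 0.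
  by rewrite mul0mx /sqnorm !mul0mx !mxtrace0 mulr0.
have su0 : 0 < sqnorm u by rewrite sqnorm_gt0.
pose c := (frobenius_norm u)^-1.
have c2 : c ^+ 2 = (sqnorm u)^-1 by rewrite /c exprVn frobenius_norm_sqr.
pose v := c *: u^T.
have sv : sqnorm v = 1 by rewrite sqnormZ sqnorm_tr c2 mulVf // gt_eqF.
have sXv : sqnorm (X *m v) = c ^+ 2 * sqnorm (u *m X^T).
  by rewrite -scalemxAr sqnormZ -[X in X *m _]trmxK -trmx_mul sqnorm_tr.
have le : frobenius_norm (X *m v) <= spectral_norm X.
  apply: ub_le_sup.
    exists (frobenius_norm X) => _ [w /= w1 <-].
    rewrite -ler_sqr ?nnegrE ?frobenius_norm_ge0 // !frobenius_norm_sqr.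
    rewrite -sqnorm_tr trmx_mul; apply: le_trans (sqnorm_mul_le _ _) _.
    rewrite sqnorm_tr -{2}[sqnorm X]mulr1 ler_wpM2l ?sqnorm_ge0 //.
    by rewrite -frobenius_norm_sqr expr_le1 ?frobenius_norm_ge0.
  by exists v => //=; rewrite frobenius_normE sv sqrtr1.
rewrite -ler_pdivrMr // mulrC -c2 -sXv -frobenius_norm_sqr.
by rewrite ler_sqr ?nnegrE ?frobenius_norm_ge0 // (le_trans _ le) ?frobenius_norm_ge0.
Qed.

(** Here [x] and [y] stand for squared lengths: the claim is the triangle
inequality followed by (a sqrt x + b sqrt y)^2 <= (a^2 + b^2) (x + y).  Square
roots are avoided by expanding
|(b/a) p + (a/b) q|^2 >= 0 to bound the cross term. *)
Lemma sqnorm_sub_le n (p q : 'rV[K]_n) a b x y :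
  0 <= x -> 0 <= y -> sqnorm p <= a ^+ 2 * x -> sqnorm q <= b ^+ 2 * y ->
  sqnorm (p - q) <= (a ^+ 2 + b ^+ 2) * (x + y).
Proof.
move=> x0 y0 px qy.
have ax := sqr_ge0 a; have bx := sqr_ge0 b.
have [a0|a0] := eqVneq a 0.
  have -> : p = 0.
    apply/eqP; rewrite -sqnorm_eq0 eq_le sqnorm_ge0 andbT.
    by rewrite (le_trans px) // a0 expr0n mul0r.
  rewrite sub0r -scaleN1r sqnormZ sqrrN expr1n mul1r (le_trans qy) //.
  by rewrite a0 expr0n add0r ler_wpM2l // lerDr.
have [b0|b0] := eqVneq b 0.
  have -> : q = 0.
    apply/eqP; rewrite -sqnorm_eq0 eq_le sqnorm_ge0 andbT.
    by rewrite (le_trans qy) // b0 expr0n mul0r.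
  rewrite subr0 (le_trans px) //.
  by rewrite b0 expr0n addr0 ler_wpM2l // lerDl.
have a2 : 0 < a ^+ 2 by rewrite exprn_even_gt0.
have b2 : 0 < b ^+ 2 by rewrite exprn_even_gt0.
pose z := (p *m q^T) 0 0.
have cross (s t : K) : sqnorm (s *: p + t *: q) =
    s ^+ 2 * sqnorm p + 2 * s * t * z + t ^+ 2 * sqnorm q.
  have -> : sqnorm (s *: p + t *: q) =
      ((s *: p + t *: q) *m (s *: p + t *: q)^T) 0 0.
    by rewrite rv_sqnorm mxE eqxx.
  rewrite [(_ + _)^T]linearD /= ![(_ *: _)^T]linearZ /= mulmxDl !mulmxDr.
  rewrite -!scalemxAl -!scalemxAr !rv_sqnorm.
  have -> : q *m p^T = (p *m q^T)^T by rewrite trmx_mul trmxK.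
  by rewrite /z !mxE /= !mulr1n; ring.
have := cross 1 (-1); rewrite scale1r scaleN1r => ->.
have := sqnorm_ge0 ((b / a) *: p + (a / b) *: q); rewrite cross.
have -> : 2 * (b / a) * (a / b) * z = 2 * z by field; rewrite a0 b0.
move=> zge.
have px' : (b / a) ^+ 2 * sqnorm p <= b ^+ 2 * x.
  rewrite expr_div_n mulrAC ler_pdivrMr // -[leRHS]mulrA ler_wpM2l //.
  by rewrite mulrC.
have qy' : (a / b) ^+ 2 * sqnorm q <= a ^+ 2 * y.
  rewrite expr_div_n mulrAC ler_pdivrMr // -[leRHS]mulrA ler_wpM2l //.
  by rewrite mulrC.
rewrite mulrDr !mulrDl; lra.
Qed.

End GramSpectrum.

(** * Column blocks *)

Section Frames.
Variable K : realType.

Definition last_cols (m n p : nat) (X : 'M[K]_(m, n)) : 'M[K]_(m, n - p) :=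
  colsub (@tail_ord n p) X.

Definition urblock (m n p q : nat) (hp : (p <= m)%N) (X : 'M[K]_(m, n)) :
  'M[K]_(p, n - q) := mxsub (widen_ord hp) (@tail_ord n q) X.

Lemma sum_widen_tail (T : nmodType) n p (h : (p <= n)%N) (F : 'I_n -> T) :
  \sum_i F i = \sum_(i < p) F (widen_ord h i) + \sum_(i < n - p) F (tail_ord i).
Proof.
rewrite (reindex (cast_ord (subnKC h))) /=; last first.
  by apply: onW_bij; exists (cast_ord (esym (subnKC h)));
    [exact: cast_ordK | exact: cast_ordKV].
by rewrite big_split_ord /=; congr (_ + _); apply: eq_bigr => i _;
  congr F; apply: val_inj.
Qed.

Lemma first_cols_mul r m n p q (hp : (p <= n)%N) (hq : (q <= m)%N)
    (X : 'M[K]_(r, m)) (Y : 'M[K]_(m, n)) :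
  first_cols hp (X *m Y) =
  first_cols hq X *m ulblock hq hp Y + last_cols q X *m dlblock q hp Y.
Proof.
apply/matrixP => i j; rewrite !mxE (sum_widen_tail hq).
by congr (_ + _); apply: eq_bigr => a _; rewrite !mxE.
Qed.

Lemma last_cols_mul m n p q r (hq : (q <= m)%N)
    (X : 'M[K]_(n, m)) (Y : 'M[K]_(m, p)) :
  last_cols r (X *m Y) =
  first_cols hq X *m urblock r hq Y + last_cols q X *m drblock q r Y.
Proof.
apply/matrixP => i j; rewrite !mxE (sum_widen_tail hq).
by congr (_ + _); apply: eq_bigr => a _; rewrite !mxE.
Qed.

Lemma ulblock_trmul m n1 n2 p q (hp : (p <= n1)%N) (hq : (q <= n2)%N)
    (X : 'M[K]_(m, n1)) (Y : 'M[K]_(m, n2)) :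
  ulblock hp hq (X^T *m Y) = (first_cols hp X)^T *m first_cols hq Y.
Proof. by apply/matrixP => i j; rewrite !mxE; apply: eq_bigr => a _; rewrite !mxE. Qed.

Lemma dlblock_trmul m n1 n2 p q (hq : (q <= n2)%N)
    (X : 'M[K]_(m, n1)) (Y : 'M[K]_(m, n2)) :
  dlblock p hq (X^T *m Y) = (last_cols p X)^T *m first_cols hq Y.
Proof. by apply/matrixP => i j; rewrite !mxE; apply: eq_bigr => a _; rewrite !mxE. Qed.

Lemma first_colsE m n p (h : (p <= n)%N) (X : 'M[K]_(m, n)) :
  first_cols h X = X *m first_cols h 1%:M.
Proof. by rewrite -[in LHS](mulmx1 X) /first_cols mulmx_colsub. Qed.

Lemma last_colsE m n p (X : 'M[K]_(m, n)) :
  last_cols p X = X *m last_cols p 1%:M.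
Proof. by rewrite -[in LHS](mulmx1 X) /last_cols mulmx_colsub. Qed.

Section Orthogonal.
Variables (n p : nat) (h : (p <= n)%N) (S : 'M[K]_n).
Hypothesis Sorth : orthogonal_mx S.

Lemma first_cols_frame : (first_cols h S)^T *m first_cols h S = 1%:M.
Proof.
rewrite -ulblock_trmul Sorth; apply/matrixP => i j; rewrite !mxE -val_eqE /=.
by rewrite val_eqE.
Qed.

Lemma last_cols_frame : (last_cols p S)^T *m last_cols p S = 1%:M.
Proof.
have -> : (last_cols p S)^T *m last_cols p S = drblock p p (S^T *m S).
  by apply/matrixP => i j; rewrite !mxE; apply: eq_bigr => a _; rewrite !mxE.
rewrite Sorth; apply/matrixP => i j; rewrite !mxE -val_eqE /= eqn_add2l.
by rewrite val_eqE.
Qed.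

Lemma last_first_cols_orth : (last_cols p S)^T *m first_cols h S = 0.
Proof.
rewrite -dlblock_trmul Sorth; apply/matrixP => i j; rewrite !mxE -val_eqE /=.
by rewrite gtn_eqF // (leq_trans (ltn_ord j)) ?leq_addr.
Qed.

Lemma first_last_cols_orth : (first_cols h S)^T *m last_cols p S = 0.
Proof. by rewrite -[last_cols p S]trmxK -trmx_mul last_first_cols_orth trmx0. Qed.

Lemma sum_cols_projections :
  first_cols h S *m (first_cols h S)^T + last_cols p S *m (last_cols p S)^T = 1%:M.
Proof.
rewrite -(orthogonal_mxC Sorth); apply/matrixP => i j.
rewrite !mxE (sum_widen_tail h).
by congr (_ + _); apply: eq_bigr => a _; rewrite !mxE.
Qed.

End Orthogonal.

Lemma orthogonal_mx1 n : orthogonal_mx (1%:M : 'M[K]_n).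
Proof. by rewrite /orthogonal_mx trmx1 mulmx1. Qed.

(** With I_1, I_2 the column blocks of the identity, the matrix
S_1 I_1^T + S_2 N I_2^T has the required columns. *)
Lemma rotate_last_cols n p (h : (p <= n)%N) (S : 'M[K]_n) (N : 'M[K]_(n - p)) :
  orthogonal_mx S -> orthogonal_mx N ->
  exists S' : 'M[K]_n, [/\ orthogonal_mx S', first_cols h S' = first_cols h S
    & last_cols p S' = last_cols p S *m N].
Proof.
move=> Sorth Northo; set S1 := first_cols h S; set S2 := last_cols p S.
pose I1 := first_cols h (1%:M : 'M[K]_n); pose I2 := last_cols p (1%:M : 'M[K]_n).
have I1o := orthogonal_mx1 n.
exists (S1 *m I1^T + S2 *m N *m I2^T); split.
- rewrite /orthogonal_mx [(_ + _)^T]linearD /= !trmx_mul !trmxK mulmxDl !mulmxDr !mulmxA.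
  rewrite -(mulmxA I1 S1^T S1) first_cols_frame // mulmx1.
  rewrite -(mulmxA I1 S1^T S2) first_last_cols_orth // mulmx0 !mul0mx addr0.
  rewrite -(mulmxA _ S2^T S1) last_first_cols_orth // mulmx0 !mul0mx add0r.
  rewrite -(mulmxA _ S2^T S2) last_cols_frame // mulmx1.
  by rewrite -(mulmxA _ N^T N) Northo mulmx1 sum_cols_projections.
- rewrite first_colsE -/I1 mulmxDl -!mulmxA first_cols_frame // last_first_cols_orth //.
  by rewrite !mulmx0 mulmx1 addr0.
- rewrite last_colsE -/I2 mulmxDl -!mulmxA last_cols_frame // first_last_cols_orth //.
  by rewrite !mulmx0 mulmx1 add0r.
Qed.

Lemma first_cols_structured n l (ln : (l <= n)%N) (V V' : 'M[K]_n) R11' :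
  is_structured ln V V' R11' -> first_cols ln V = first_cols ln V' *m R11'.
Proof.
case=> _ _ _ ->; rewrite (first_cols_mul ln ln).
have -> : ulblock ln ln (castmx (subnKC ln, subnKC ln)
    (block_mx R11' 0 0 1%:M)) = R11'.
  apply/matrixP => i j; rewrite mxE castmxE /=.
  have lsh (a : 'I_l) : cast_ord (esym (subnKC ln)) (widen_ord ln a) = lshift _ a.
    exact: val_inj.
  by rewrite !lsh block_mxEul.
have -> : dlblock l ln (castmx (subnKC ln, subnKC ln)
    (block_mx R11' 0 0 1%:M)) = 0.
  apply/matrixP => i j; rewrite mxE castmxE /=.
  have -> : cast_ord (esym (subnKC ln)) (widen_ord ln j) = lshift _ j by exact: val_inj.
  have -> : cast_ord (esym (subnKC ln)) (tail_ord i) = rshift _ i by exact: val_inj.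
  by rewrite block_mxEdl.
by rewrite mulmx0 addr0.
Qed.

Lemma last_cols_structured n l (ln : (l <= n)%N) (V V' : 'M[K]_n) R11' :
  is_structured ln V V' R11' -> last_cols l V = last_cols l V'.
Proof.
case=> _ _ _ ->; rewrite (last_cols_mul _ ln).
have -> : urblock l ln (castmx (subnKC ln, subnKC ln)
    (block_mx R11' 0 0 1%:M)) = 0.
  apply/matrixP => i j; rewrite mxE castmxE /=.
  have -> : cast_ord (esym (subnKC ln)) (widen_ord ln i) = lshift _ i by exact: val_inj.
  have -> : cast_ord (esym (subnKC ln)) (tail_ord j) = rshift _ j by exact: val_inj.
  by rewrite block_mxEur mxE.
have -> : drblock l l (castmx (subnKC ln, subnKC ln)
    (block_mx R11' 0 0 1%:M)) = 1%:M.
  apply/matrixP => i j; rewrite mxE castmxE /=.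
  have rsh (a : 'I_(n - l)) : cast_ord (esym (subnKC ln)) (tail_ord a) = rshift _ a.
    exact: val_inj.
  by rewrite !rsh block_mxEdr.
by rewrite mulmx0 mulmx1 add0r.
Qed.

Lemma qr_first_cols m n l (lm : (l <= m)%N) (ln : (l <= n)%N) (X : 'M[K]_(m, n)) Q R :
  is_qr X Q R -> first_cols ln X = first_cols lm Q *m ulblock lm ln R.
Proof.
case=> _ /is_trig_mxP Rtrig ->; rewrite (first_cols_mul _ lm).
suff -> : dlblock l ln R = 0 by rewrite mulmx0 addr0.
apply/matrixP => i j; rewrite !mxE.
have := Rtrig (widen_ord ln j) (tail_ord i); rewrite mxE; apply => /=.
by rewrite (leq_trans (ltn_ord j)) // leq_addr.
Qed.

(** * The pseudo-inverse and the projected factor *)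

Lemma row_free_trmul_unit k l (M : 'M[K]_(k, l)) : row_free M ->
  M *m M^T \in unitmx.
Proof.
move=> Mfree; rewrite -row_free_unit; apply: inj_row_free => u uMM.
apply/eqP; rewrite -(mulmx_free_eq0 _ Mfree) -sqnorm_eq0 /sqnorm trmx_mul mulmxA.
by rewrite -(mulmxA u) uMM mul0mx mxtrace0.
Qed.

(** M^T (M M^T)^-1 satisfies the Penrose equations, so the pseudo-inverse is
not the default value; M Y M = M then allows cancelling M on the right. *)
Lemma mulmx_pseudo_inverse k l (M : 'M[K]_(k, l)) : row_free M ->
  M *m pseudo_inverse M = 1%:M.
Proof.
move=> Mfree; have Gunit := row_free_trmul_unit Mfree.
have : is_pseudo_inverse M (pseudo_inverse M).
  apply: xgetPex; exists (M^T *m invmx (M *m M^T)).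
  have MY : M *m (M^T *m invmx (M *m M^T)) = 1%:M by rewrite mulmxA mulmxV.
  split; rewrite ?MY ?mul1mx ?trmx1 //.
    by rewrite -mulmxA MY mulmx1.
  by rewrite !trmx_mul trmxK trmx_inv trmx_mul trmxK mulmxA.
case=> MYM _ _ _; apply: (row_free_inj Mfree).
by rewrite mul1mx.
Qed.

(** [V1] times the pseudo-inverse Y of S1^T V1 has S1-component 1 and
S2-component [W].  Since Q2^T annihilates A V1 Y, it satisfies
Q2^T A S1 = - Q2^T P2 D2 W, and A = A S1 S1^T + A S2 S2^T. *)
Lemma projected_factor m n q k l p p' (A : 'M[K]_(m, n)) (Q2 : 'M[K]_(m, q))
    (V1 : 'M[K]_(n, l)) (S1 : 'M[K]_(n, k)) (S2 : 'M[K]_(n, p))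
    (P2 : 'M[K]_(m, p')) (D2 : 'M[K]_(p', p)) :
  Q2^T *m (A *m V1) = 0 -> S1 *m S1^T + S2 *m S2^T = 1%:M ->
  A *m S2 = P2 *m D2 -> row_free (S1^T *m V1) ->
  let W := S2^T *m V1 *m pseudo_inverse (S1^T *m V1) in
  Q2^T *m A = Q2^T *m P2 *m D2 *m (S2^T - W *m S1^T).
Proof.
move=> QAV SS AS2 Mfree W; pose Y := pseudo_inverse (S1^T *m V1).
have AVY : A *m V1 *m Y = A *m S1 + P2 *m D2 *m W.
  rewrite -[A in LHS]mulmx1 -SS mulmxDr !mulmxA AS2 !mulmxDl -!mulmxA.
  by congr (_ + _); rewrite (mulmxA S1^T) mulmx_pseudo_inverse // mulmx1.
have QAS1 : Q2^T *m (A *m S1) = - (Q2^T *m (P2 *m D2 *m W)).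
  apply/eqP; rewrite -addr_eq0 -mulmxDr -AVY.
  by rewrite !mulmxA -(mulmxA Q2^T) QAV mul0mx.
rewrite -[LHS]mulmx1 -SS mulmxDr !mulmxA -(mulmxA Q2^T A S1) QAS1.
by rewrite -(mulmxA Q2^T A S2) AS2 mulmxBr !mulmxA mulNmx addrC.
Qed.

Lemma sqnorm_sum_frames m n p q (G : 'M[K]_(n, p)) (H : 'M[K]_(n, q))
    (X : 'M[K]_(m, p)) (Y : 'M[K]_(m, q)) :
  G^T *m G = 1%:M -> H^T *m H = 1%:M -> G^T *m H = 0 ->
  sqnorm (X *m G^T - Y *m H^T) = sqnorm X + sqnorm Y.
Proof.
move=> GG HH GH; rewrite /sqnorm [(_ - _)^T]linearB /= mulmxBl !mulmxBr !trmx_mul !trmxK.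
have HG : H^T *m G = 0 by rewrite -[H^T *m G]trmxK trmx_mul trmxK GH trmx0.
rewrite !mulmxA -!(mulmxA _ _ G) -!(mulmxA _ _ H) GG HH GH HG.
by rewrite !mulmx1 !mulmx0 !mul0mx subr0 sub0r opprK linearD.
Qed.

End Frames.

(** * The structured QR factorization *)

Section StructuredQR.
Variables (K : realType) (m n l : nat) (lm : (l <= m)%N) (ln : (l <= n)%N).
Variables (A : 'M[K]_(m, n)).

Lemma svd_first_cols k (km : (k <= m)%N) (kn : (k <= n)%N) P S s :
  orthogonal_mx S -> A = P *m rect_diag m n s *m S^T ->
  A *m first_cols kn S = first_cols km P *m rect_diag k k s.
Proof.
move=> Sorth AE; rewrite AE.
have -> : P *m rect_diag m n s *m S^T *m first_cols kn S =
    first_cols kn (P *m rect_diag m n s).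
  by rewrite -mulmxA [RHS]first_colsE /first_cols mulmx_colsub Sorth.
rewrite (first_cols_mul kn km); have -> : dlblock k kn (rect_diag m n s) = 0.
  apply/matrixP => i j; rewrite !mxE /= gtn_eqF //.
  by rewrite (leq_trans (ltn_ord j)) // leq_addr.
rewrite mulmx0 addr0; congr (_ *m _).
by apply/matrixP => i j; rewrite !mxE.
Qed.

Lemma svd_last_cols k (km : (k <= m)%N) P S s :
  orthogonal_mx S -> A = P *m rect_diag m n s *m S^T ->
  A *m last_cols k S = last_cols k P *m drblock k k (rect_diag m n s).
Proof.
move=> Sorth AE; rewrite AE.
have -> : P *m rect_diag m n s *m S^T *m last_cols k S =
    last_cols k (P *m rect_diag m n s).
  by rewrite -mulmxA [RHS]last_colsE /last_cols mulmx_colsub Sorth.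
rewrite (last_cols_mul _ km); have -> : urblock k km (rect_diag m n s) = 0.
  apply/matrixP => i j; rewrite !mxE /= ltn_eqF //.
  by rewrite (leq_trans (ltn_ord i)) // leq_addr.
by rewrite mulmx0 add0r.
Qed.

Section Factorization.
Variables (V V' : 'M[K]_n) (R11' : 'M[K]_l) (Q : 'M[K]_m) (R : 'M[K]_(m, n)).
Hypotheses (VE : is_structured ln V V' R11') (AVE : is_qr (A *m V) Q R).

Let Q1 := first_cols lm Q.
Let Q2 := last_cols l Q.
Let Qorth : orthogonal_mx Q. Proof. by case: AVE. Qed.
Let V'orth : orthogonal_mx V'. Proof. by case: VE. Qed.

Lemma qr_head : A *m first_cols ln V = Q1 *m ulblock lm ln R.
Proof. by rewrite -(qr_first_cols lm ln AVE) /first_cols mulmx_colsub. Qed.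

Lemma qr_head_structured :
  A *m first_cols ln V' = Q1 *m (ulblock lm ln R *m invmx R11').
Proof.
have [_ _ R11unit _] := VE.
rewrite mulmxA -qr_head (first_cols_structured VE) mulmxA.
by rewrite mulmxK.
Qed.

Lemma qr_tail_head : Q2^T *m (A *m first_cols ln V) = 0.
Proof. by rewrite qr_head mulmxA last_first_cols_orth // mul0mx. Qed.

Lemma qr_tail_head_structured : Q2^T *m (A *m first_cols ln V') = 0.
Proof. by rewrite qr_head_structured mulmxA last_first_cols_orth // mul0mx. Qed.

Lemma qr_tail_tail : Q2^T *m (A *m last_cols l V') = drblock l l R.
Proof.
rewrite -(last_cols_structured VE).
have -> : A *m last_cols l V = last_cols l (A *m V) by rewrite /last_cols mulmx_colsub.
case: AVE => _ _ ->; rewrite (last_cols_mul _ lm) mulmxDr !mulmxA.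
by rewrite last_first_cols_orth // last_cols_frame // mul0mx mul1mx add0r.
Qed.

Lemma residualE : Q1 *m Q1^T *m A - A = Q2 *m (- drblock l l R) *m (last_cols l V')^T.
Proof.
have E : Q2^T *m A = drblock l l R *m (last_cols l V')^T.
  rewrite -[LHS]mulmx1 -(sum_cols_projections ln V'orth) mulmxDr !mulmxA.
  rewrite -!(mulmxA Q2^T A) qr_tail_head_structured qr_tail_tail.
  by rewrite mul0mx add0r.
rewrite -[A in _ - A]mul1mx -(sum_cols_projections lm Qorth) mulmxDl opprD addrA.
by rewrite subrr add0r -(mulmxA Q2 Q2^T A) E mulmxN mulNmx mulmxA.
Qed.

Lemma sigma_residual i : (0 < i)%N ->
  sigma (Q1 *m Q1^T *m A - A) i = sigma (drblock l l R) i.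
Proof.
move=> i0; rewrite residualE -[RHS]sigma_opp.
have Q2Q2 := last_cols_frame l Qorth; have V2V2 := last_cols_frame l V'orth.
apply/eqP; rewrite eq_le; apply/andP; split.
  apply: le_trans (sigma_mulr _ i0 _) (sigma_mull _ i0 _).
    by rewrite trmxK; apply: contraction_frame.
  exact: contraction_frame_tr.
have E : - drblock l l R =
    Q2^T *m (Q2 *m - drblock l l R *m (last_cols l V')^T *m last_cols l V').
  by rewrite -!mulmxA V2V2 mulmx1 mulmxA Q2Q2 mul1mx.
rewrite [X in sigma X _ <= _]E.
apply: le_trans (sigma_mull _ i0 _) (sigma_mulr _ i0 _).
  by rewrite trmxK; apply: contraction_frame.
exact: contraction_frame_tr.
Qed.

Lemma sigma_projection_le j : (0 < j)%N -> sigma (Q1 *m Q1^T *m A) j <= sigma A j.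
Proof.
move=> j0; rewrite -mulmxA; have Q1Q1 := first_cols_frame lm Qorth.
apply: le_trans (sigma_mull _ j0 _) (sigma_mull _ j0 _).
  exact: contraction_frame_tr.
by rewrite trmxK; apply: contraction_frame.
Qed.

Lemma sigma_compression_le j : (0 < j)%N ->
  sigma (ulblock lm ln R *m invmx R11') j <= sigma (Q1 *m Q1^T *m A) j.
Proof.
move=> j0; have Q1Q1 := first_cols_frame lm Qorth.
have V1V1 := first_cols_frame ln V'orth.
have -> : ulblock lm ln R *m invmx R11' =
    Q1^T *m (Q1 *m Q1^T *m A *m first_cols ln V').
  by rewrite !mulmxA Q1Q1 mul1mx -mulmxA qr_head_structured mulmxA Q1Q1 mul1mx.
apply: le_trans (sigma_mull _ j0 _) (sigma_mulr _ j0 _).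
  by rewrite trmxK; apply: contraction_frame.
exact: contraction_frame_tr.
Qed.

(** Q_1 (R_11 R'_11^-1) = A V'_1 contracts to P_1^T A V'_1, which is
diag(sigma_1, ..., sigma_k) S_1^T V'_1 as P diagonalizes A. *)
Lemma sigma_compression_ge k (km : (k <= m)%N) (kn : (k <= n)%N)
    P Sg S j : is_svd A P Sg S -> (1 <= j <= k)%N ->
  sigma A j * sigma (ulblock kn ln (S^T *m V')) k
    <= sigma (ulblock lm ln R *m invmx R11') j.
Proof.
case=> Porth Sorth [s [s0 s_mono SgE]] AE /andP[j0 jk].
have Q1Q1 := first_cols_frame lm Qorth.
pose D1 := rect_diag k k s.
have sAj : sigma A j = sigma D1 j.
  rewrite -(prednK j0).
  rewrite (sigma_of_svd (P := P) (S := S) _ _ _ s0 s_mono) -?SgE //.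
  rewrite (sigma_of_svd (P := 1%:M) (S := 1%:M) _ _ _ s0 s_mono) //; try exact: orthogonal_mx1.
    have -> : (j.-1 < minn m n)%N by lia.
    by have -> : (j.-1 < minn k k)%N by lia.
  by rewrite mul1mx trmx1 mulmx1.
rewrite sAj; apply: le_trans (sigma_mul_ge _ _ _) _; first by rewrite j0.
have -> : D1 *m ulblock kn ln (S^T *m V') =
    (first_cols km P)^T *m (Q1 *m (ulblock lm ln R *m invmx R11')).
  rewrite -qr_head_structured ulblock_trmul !mulmxA; congr (_ *m _).
  rewrite SgE in AE; rewrite -[RHS]mulmx1 -(sum_cols_projections kn Sorth) mulmxDr !mulmxA.
  rewrite -(mulmxA _ A) (svd_first_cols km kn Sorth AE).
  rewrite -(mulmxA _ A) (svd_last_cols km Sorth AE) !mulmxA.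
  by rewrite first_cols_frame // first_last_cols_orth // !mul0mx addr0 mul1mx.
apply: le_trans (sigma_mull _ j0 _) (sigma_mull _ j0 _).
  by rewrite trmxK; apply/contraction_frame/first_cols_frame.
exact: contraction_frame_tr.
Qed.

(** The frame [P2] carries the trailing block D2 of a diagonalization of A, and
D2 is F up to the orthogonal changes of coordinates [L], [N] and a matrix [B]
of rank at most [r].  Inserting this into the projected factor exhibits R_22 as
a contraction of F S'_2^T - F W S'_1^T plus a matrix of rank at most [r]. *)
Lemma sigma_trailing_block_le k (kn : (k <= n)%N) p' (S S' : 'M[K]_n) (N : 'M[K]_(n - k))
    (P2 : 'M[K]_(m, p')) (L : 'M[K]_p') (F B D2 : 'M[K]_(p', n - k)) r :
  P2^T *m P2 = 1%:M -> L^T *m L = 1%:M -> orthogonal_mx S ->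
  first_cols kn S' = first_cols kn S -> last_cols k S' = last_cols k S *m N ->
  A *m last_cols k S = P2 *m D2 -> D2 = L *m F *m N^T + B -> (\rank B <= r)%N ->
  row_free (ulblock kn ln (S^T *m V)) ->
  let W := block_ratio kn ln (S'^T *m V) in
  forall i, (0 < i)%N -> sigma (drblock l l R) (i + r) <=
    sigma (F *m (last_cols k S')^T - F *m W *m (first_cols kn S')^T) i.
Proof.
move=> P2P2 LL Sorth S'1 S'2 AS2 D2E Br Mfree W i i0.
set Z := (X in _ <= sigma X i).
have V2V2 := last_cols_frame l V'orth; have Q2Q2 := last_cols_frame l Qorth.
rewrite ulblock_trmul in Mfree.
have := projected_factor qr_tail_head (sum_cols_projections kn Sorth) AS2 Mfree.
set W0 := _ *m pseudo_inverse _ => /= Q2A.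
pose Z0 := (last_cols k S)^T - W0 *m (first_cols kn S)^T.
rewrite -/Z0 in Q2A.
have WE : W = N^T *m W0.
  by rewrite /W /block_ratio ulblock_trmul dlblock_trmul S'1 S'2 trmx_mul !mulmxA.
have ZE : F *m N^T *m Z0 = Z.
  by rewrite /Z /Z0 mulmxBr S'1 S'2 WE trmx_mul !mulmxA.
have RE : drblock l l R = Q2^T *m P2 *m L *m Z *m last_cols l V' +
    Q2^T *m P2 *m B *m Z0 *m last_cols l V'.
  rewrite -qr_tail_tail mulmxA Q2A D2E -ZE.
  by rewrite mulmxDr !mulmxDl !mulmxA.
set B' := (X in _ + X) in RE.
apply: le_trans (sigma_weyl (B := B') _ i0 _) _.
  apply: leq_trans Br; rewrite /B'; apply: leq_trans (mxrankM_maxl _ _) _.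
  by apply: leq_trans (mxrankM_maxl _ _) _; apply: mxrankM_maxr.
rewrite RE addrK -!mulmxA.
apply: le_trans (sigma_mull _ i0 _) _; first by rewrite trmxK; apply: contraction_frame.
apply: le_trans (sigma_mull _ i0 _) _; first exact: contraction_frame_tr.
apply: le_trans (sigma_mull _ i0 _) _; first exact: contraction_frame_tr.
by apply: sigma_mulr => //; apply: contraction_frame_tr.
Qed.

End Factorization.
End StructuredQR.

Section Deflation.
Variable K : realType.

(** * The norms of the deflated factor *)

Lemma sigma_deflated k n p (F : 'M[K]_(p, n - k)) (W : 'M[K]_(n - k, k)) (kn : (k <= n)%N)
    (S : 'M[K]_n) : orthogonal_mx S ->
  sigma (F *m (last_cols k S)^T - F *m W *m (first_cols kn S)^T) 1 ^+ 2 <=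
  sigma F 1 ^+ 2 + spectral_norm (F *m W) ^+ 2.
Proof.
move=> Sorth; apply: sigma1_le; first by rewrite addr_ge0 ?sqr_ge0.
move=> u; rewrite [(_ - _)^T]linearB /= !(trmx_mul _ (_^T)) !trmxK mulmxBr !mulmxA.
have -> : sqnorm u = sqnorm (u *m last_cols k S) + sqnorm (u *m first_cols kn S).
  have := sqnorm_sum_frames (u *m last_cols k S) (- (u *m first_cols kn S))
    (last_cols_frame k Sorth) (first_cols_frame kn Sorth) (last_first_cols_orth kn Sorth).
  rewrite mulNmx opprK -!mulmxA -mulmxDr addrC sum_cols_projections // mulmx1 => ->.
  by rewrite -[- (_ *m _)]scaleN1r sqnormZ sqrrN expr1n mul1r.
apply: sqnorm_sub_le; rewrite ?sqnorm_ge0 //.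
  exact: sqnorm_le_sigma1.
exact: spectral_normP.
Qed.

Lemma sqnorm_deflated k n p (F : 'M[K]_(p, n - k)) (W : 'M[K]_(n - k, k)) (kn : (k <= n)%N)
    (S : 'M[K]_n) : orthogonal_mx S ->
  sqnorm (F *m (last_cols k S)^T - F *m W *m (first_cols kn S)^T) =
  sqnorm F + sqnorm (F *m W).
Proof.
by move=> So; apply: sqnorm_sum_frames; [exact: last_cols_frame | exact: first_cols_frame
  | exact: last_first_cols_orth].
Qed.

(** * The cyclic renumbering *)

Lemma rotation_perm p c : (c <= p)%N -> exists s : 'S_p,
  forall i : 'I_p, s i = (if (i + c < p)%N then i + c else i + c - p)%N :> nat.
Proof.
move=> cp; pose f (i : nat) := (if (i + c < p)%N then i + c else i + c - p)%N.
have fp (i : 'I_p) : (f i < p)%N by rewrite /f; have := ltn_ord i; case: ifP; lia.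
have f_inj : injective (fun i => Ordinal (fp i)).
  move=> i j /(congr1 val) /=; rewrite /f => ij; apply: val_inj => /=.
  by move: ij (ltn_ord i) (ltn_ord j); case: ifP; case: ifP; lia.
by exists (perm f_inj) => i; rewrite permE.
Qed.

(** Shifting the row and column indices cyclically by j - 1 moves the diagonal
entries sigma_(k+j), sigma_(k+j+1), ... of Sigma_2 to the front.  The j - 1
entries that wrap around lie in the first j - 1 rows of Sigma_2, and the
remainder [B] is supported there.  The row and column shifts have different
periods when m and n differ, but below the first j - 1 rows the two sides can
disagree only at indices beyond the dimensions of A, where sigma vanishes. *)
Lemma Sigma_j2_shift m n (A : 'M[K]_(m, n)) k j :
  (1 <= j <= minn m n - k)%N ->
  exists (L : 'M[K]_(m - k)) (N : 'M[K]_(n - k)) (B : 'M[K]_(m - k, n - k)),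
    [/\ orthogonal_mx L, orthogonal_mx N, (\rank B <= j.-1)%N
      & drblock k k (rect_diag m n (fun i => sigma A i.+1)) =
        L *m Sigma_j2 A k j *m N^T + B].
Proof.
move=> j_bounds.
have [|a aE] := @rotation_perm (m - k) j.-1; first by lia.
have [|b bE] := @rotation_perm (n - k) j.-1; first by lia.
set D := drblock _ _ _.
pose F := Sigma_j2 A k j.
exists (perm_mx a^-1), (perm_mx b^-1), (D - perm_mx a^-1 *m F *m (perm_mx b^-1)^T).
have perm_orth q (s : 'S_q) : orthogonal_mx (perm_mx s : 'M[K]_q).
  by rewrite /orthogonal_mx tr_perm_mx -perm_mxM mulVg perm_mx1.
split; [exact: perm_orth | exact: perm_orth | | by rewrite addrC subrK].
set B := D - _.
(* The rows of [B] from the index j - 1 on are zero. *)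
suff -> : B = pid_mx j.-1 *m B.
  by apply: leq_trans (mxrankM_maxl _ _) _; rewrite rank_pid_mx //; lia.
apply/matrixP => x y; rewrite [RHS]mxE (bigD1 x) //= big1 => [|z zx]; last first.
  rewrite mxE (_ : (x == z :> nat) = false) ?mul0r // eq_sym; exact: negPf zx.
rewrite addr0 [pid_mx _ _ _]mxE eqxx /=; case: ltnP => xj; first by rewrite mul1r.
rewrite mul0r.
have BE (u : 'I_(m - k)) (v : 'I_(n - k)) : B (a u) (b v) = D (a u) (b v) - F u v.
  rewrite /B tr_perm_mx invgK -row_permE -[in perm_mx b](invgK b) -col_permE.
  by rewrite !mxE !permK.
rewrite -[x](permKV a) -[y](permKV b) BE.
move: xj; rewrite -[x in X in X -> _](permKV a).
move: ((a^-1)%g x) ((b^-1)%g y) => u v; rewrite !mxE /= eqn_add2l aE bE.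
move: (ltn_ord u) (ltn_ord v); move: (nat_of_ord u) (nat_of_ord v) => {}u {}v um vn xj.
have uj : (u + j.-1 < m - k)%N by move: xj; case: ifP; lia.
rewrite uj; case: (ltnP (v + j.-1) (n - k)) => vj.
  case: eqP => uv; case: eqP => uv'; rewrite ?subrr //; try lia.
  by apply/eqP; rewrite subr_eq0; apply/eqP; congr sigma; lia.
case: eqP => uv; first by lia.
by case: eqP => uv'; rewrite ?subrr // sigma_oversize ?subrr //; lia.
Qed.

Lemma svd_rect_diag m n (A : 'M[K]_(m, n)) P D S : is_svd A P D S ->
  D = rect_diag m n (fun i => sigma A i.+1).
Proof.
case=> Porth Sorth [s [s0 s_mono DE]] AE; rewrite DE; apply/matrixP => i j.
rewrite !mxE; case: eqP => // ij; rewrite DE in AE.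
rewrite (sigma_of_svd _ Porth Sorth s0 s_mono AE).
by rewrite leq_min ltn_ord ij ltn_ord.
Qed.

Lemma sigma1_Sigma_j2 m n (A : 'M[K]_(m, n)) k j : (0 < j)%N ->
  sigma (Sigma_j2 A k j) 1 <= sigma A (j + k).
Proof.
move=> j0.
have o1 p : orthogonal_mx (1%:M : 'M[K]_p) by exact: orthogonal_mx1.
rewrite (sigma_of_svd (P := 1%:M) (S := 1%:M) (s := fun i => sigma A (k + j + i))) //.
- by case: ifP => _; rewrite ?sigma_ge0 // addn0 addnC.
- by move=> i; rewrite sigma_ge0.
- by move=> i i' ii'; apply: sigma_anti; lia.
- by rewrite mul1mx trmx1 mulmx1.
Qed.

End Deflation.

(** * Bounds for the truncated factorization *)

Unset Implicit Arguments.

Theorem proposition4p3 (K : realType) (m n k l : nat)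
  (k_gt0 : (0 < k)%N) (kl : (k <= l)%N) (lm : (l <= m)%N) (ln : (l <= n)%N)
  (A : 'M[K]_(m, n)) (P : 'M[K]_m) (Sg : 'M[K]_(m, n)) (S : 'M[K]_n)
  (svdA : is_svd A P Sg S) :
  let kn := leq_trans kl ln in
  (forall (V V' : 'M[K]_n) (R11' : 'M[K]_l) (Q : 'M[K]_m) (R : 'M[K]_(m, n)),
     is_structured ln V V' R11' -> is_qr (A *m V) Q R ->
     row_free (ulblock kn ln (S^T *m V)) ->
     let Q1 := first_cols lm Q in
     let R11 := ulblock lm ln R in
     let R22 := drblock l l R in
     let Sg2 := drblock k k Sg in
     [/\ forall i, (0 < i)%N -> sigma (Q1 *m Q1^T *m A - A) i = sigma R22 i,
         frobenius_norm R22 ^+ 2 <=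
           frobenius_norm Sg2 ^+ 2
           + frobenius_norm (Sg2 *m block_ratio kn ln (S^T *m V)) ^+ 2
       & forall j, (1 <= j <= k)%N ->
           [/\ sigma (Q1 *m Q1^T *m A) j <= sigma A j,
               sigma (R11 *m invmx R11') j <= sigma (Q1 *m Q1^T *m A) j
             & sigma A j * sigma_min (ulblock kn ln (S^T *m V'))
                 <= sigma (R11 *m invmx R11') j]])
  /\
  (forall j, (1 <= j <= minn m n - k)%N ->
     exists2 St : 'M[K]_n, orthogonal_mx St &
     forall (V V' : 'M[K]_n) (R11' : 'M[K]_l) (Q : 'M[K]_m) (R : 'M[K]_(m, n)),
       is_structured ln V V' R11' -> is_qr (A *m V) Q R ->
       row_free (ulblock kn ln (S^T *m V)) ->
       let R22 := drblock l l R in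
       let Sj2 := Sigma_j2 A k j in
       let W := block_ratio kn ln (St^T *m V) in
       sigma R22 j ^+ 2
         <= sigma A (j + k) ^+ 2 + spectral_norm (Sj2 *m W) ^+ 2
       /\ (forall Y, is_truncated_svd j.-1 R22 Y ->
             frobenius_norm (R22 - Y) ^+ 2
               <= frobenius_norm Sj2 ^+ 2 + frobenius_norm (Sj2 *m W) ^+ 2)).
Proof.
have SgE := svd_rect_diag svdA; have km := leq_trans kl lm.
have [Porth Sorth _ AE] := svdA.
move=> kn.
have AS2 : A *m last_cols k S = last_cols k P *m drblock k k Sg.
  by rewrite [in RHS]SgE; apply: svd_last_cols => //; rewrite -SgE.
have P2P2 := last_cols_frame k Porth.
split=> [V V' R11' Q R VE AVE Mfree Q1 R11 R22 Sg2 | j j_bounds].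
  split=> [i i0||j j_bounds].
  - exact: (sigma_residual lm VE AVE).
  - (* No singular value is split off, so S itself serves. *)
    rewrite !frobenius_norm_sqr -(sqnorm_deflated _ _ kn Sorth) [sqnorm R22]sum_sigma_sqr.
    apply: (sum_sigma_weyl (r := 0)) => i i0.
    apply: (sigma_trailing_block_le lm VE AVE P2P2 (orthogonal_mx1 _ _) Sorth (B := 0)
      (D2 := Sg2) (N := 1%:M)); rewrite ?mulmx1 ?mxrank0 //.
    by rewrite trmx1 mulmx1 mul1mx addr0.
  - have [j0 _] := andP j_bounds; split.
    + exact: (sigma_projection_le lm AVE).
    + exact: (sigma_compression_le lm VE AVE).
    + exact: (sigma_compression_ge lm VE AVE km kn svdA).
have [L [N [B [Lorth Northo Br D2E]]]] := Sigma_j2_shift A j_bounds.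
have [St [Storth St1 St2]] := rotate_last_cols kn Sorth Northo.
exists St => // V V' R11' Q R VE AVE Mfree R22 Sj2 W.
rewrite -SgE in D2E.
have weyl := sigma_trailing_block_le lm VE AVE P2P2 Lorth Sorth St1 St2 AS2 D2E Br Mfree.
have j0 : (0 < j)%N by case/andP: j_bounds.
split=> [|Y YE].
  apply: le_trans (_ : sigma Sj2 1 ^+ 2 + spectral_norm (Sj2 *m W) ^+ 2 <= _).
    apply: le_trans (sigma_deflated _ _ kn Storth).
    rewrite ler_sqr ?nnegrE ?sigma_ge0 //.
    by have := weyl 1%N isT; rewrite add1n prednK.
  by rewrite lerD2r ler_sqr ?nnegrE ?sigma_ge0 // sigma1_Sigma_j2.
rewrite !frobenius_norm_sqr (truncated_svd_dist YE) -(sqnorm_deflated _ _ kn Storth).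
exact: sum_sigma_weyl.
Qed.
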